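(* Let $G$ be a countable abelian group with $\ell=[G:2G]<\infty$ and $r=|\ker(D)|<\infty$, where $D:G\to G$, $D(g)=2g$. Then the following hold: (a) $\alpha_G=\min\{1,\frac{r}{\ell}\}$. In particular, $G$ admits a Følner sequence that is quasi-invariant with respect to doubling. (b) There exists a Følner sequence $\Phi$ in $G$ such that $\alpha_\Phi=\alpha_G$.
   Context: For $g\in G$, $2g:=g+g$; $2G=\{2g: g\in G\}$. For $C\subset G$, $C/2:=D^{-1}(C)=\{g\in G: 2g\in C\}$. A Følner sequence in $G$ is a sequence $\Phi=(\Phi_N)_{N\in\mathbb{N}}$ of (nonempty) finite subsets of $G$ with $\lim_{N\to\infty}\frac{|\Phi_N\cap(g+\Phi_N)|}{|\Phi_N|}=1$ for every $g\in G$; $\mathcal{F}_G$ is the set of all Følner sequences in $G$. The doubling ratio of $\Phi$ is $\alpha_\Phi=\liminf_{N\to\infty}\frac{|(\Phi_N/2)\cap\Phi_N|}{|\Phi_N|}$; $\Phi$ is quasi-invariant with respect to doubling if $\alpha_\Phi>0$. The group doubling ratio is $\alpha_G=\sup\{\alpha_\Phi:\Phi\in\mathcal{F}_G\}$. *)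

(* Defs.v *)
From HB Require Import structures.
From mathcomp Require Import all_boot all_order all_algebra.
From mathcomp Require Import finmap.
From mathcomp Require Import all_classical all_reals all_analysis.
Set Implicit Arguments.
Unset Strict Implicit.
Unset Printing Implicit Defensive.
Import Order.TTheory GRing.Theory Num.Theory.
Import numFieldNormedType.Exports.
Local Open Scope classical_set_scope.
Local Open Scope ring_scope.
Local Open Scope fset_scope.

Definition dbl (G : zmodType) (g : G) : G := g *+ 2.

Definition dbl_ker (G : zmodType) : set G := @dbl G @^-1` [set 0].
Arguments dbl_ker G : clear implicits.

(* The quotient G / 2G, as the set of cosets g + 2G. *)
Definition dbl_cosets (G : zmodType) : set (set G) :=
  range (fun g : G => [set (g + h)%R | h in range (@dbl G)]).
Arguments dbl_cosets G : clear implicits.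

(* C / 2, the preimage of C under doubling (not a division). *)
Definition dbl_half (G : zmodType) (C : {pred G}) : {pred G} :=
  [pred g | dbl g \in C].

Definition translate (G : zmodType) (g : G) (A : {fset G}) : {fset G} :=
  [fset (g + x)%R | x in A].

Definition folner (R : realType) (G : zmodType) (Phi : nat -> {fset G}) : Prop :=
  (forall N, Phi N != fset0) /\
  forall g : G,
    (#|` Phi N `&` translate g (Phi N)|%:R / #|` Phi N|%:R : R)
      @[N --> \oo] --> (1 : R).

(* The liminf and the supremum below are taken in the extended reals, where
   they exist without any boundedness or nonemptiness side condition. *)
Definition doubling_ratio (R : realType) (G : zmodType)
    (Phi : nat -> {fset G}) : \bar R :=
  limn_einf (fun N =>
    (#|` [fset g in Phi N | g \in dbl_half (mem (Phi N))]|%:R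
       / #|` Phi N|%:R : R)%:E).

Definition quasi_invariant (R : realType) (G : zmodType)
    (Phi : nat -> {fset G}) : Prop :=
  (0 < doubling_ratio R Phi)%E.

Definition group_doubling_ratio (R : realType) (G : zmodType) : \bar R :=
  ereal_sup [set doubling_ratio R Phi | Phi in @folner R G].

(* Main.v *)
Require Import Defs.
From HB Require Import structures.
From mathcomp Require Import all_boot all_order all_algebra.
From mathcomp Require Import finmap.
From mathcomp Require Import all_classical all_reals all_analysis.
From mathcomp Require Import zify ring.
Set Implicit Arguments.
Unset Strict Implicit.
Unset Printing Implicit Defensive.
Import Order.TTheory GRing.Theory Num.Theory.
Import numFieldNormedType.Exports.
Local Open Scope classical_set_scope.
Local Open Scope ring_scope.

(** The upper bound comes from equidistribution among the cosets of [2G].  If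
    [A] is almost invariant, then [A] meets all [l] cosets in about equally many
    points, so about [|A| / l] points of [A] are divisible by two.  Each of them
    has exactly [r] halves, hence the set [A / 2] has about [(r / l) |A|]
    elements ([card_half_bounds]).  The points of [A] whose double lies in [A]
    form the set [A / 2] intersected with [A], so their proportion is at most
    about [min (1, r / l)] ([doubling_ratio_le]).

    For the lower bound, start from a set [C] that is almost invariant in very
    many directions, and let [A] be the union of [C], [C / 2], ..., [C / 2 ^ k].
    Halving preserves almost invariance, because translating [C / 2] by [g]
    amounts to translating [C] by [2 g]; so [A] is almost invariant as well, for
    fixed [k] and good enough [C] ([halvings_almost_invariant]).
    - If [r <= l], the successive layers that make up [A] have essentially
      nonincreasing sizes, so the layer which the next halving would add is at
      most about a fraction [1 / k] of [A].  Hence nearly all of [A / 2] lies in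
      [A], and the proportion is about [r / l] ([card_half_exit_le]).
    - If [l < r], each halving enlarges an almost invariant set by at least a
      fixed fraction of [|C|], so [C] is a small part of [A] when [k] is large.
      Every point of [A] outside of [C] has its double in [A], and the
      proportion is close to [1] ([card_halvings_ge]).

    Choosing such sets for better and better precision along an enumeration of
    [G] gives a Folner sequence that attains the upper bound
    ([optimal_folner]), which settles all three claims at once.

    Almost invariant sets to start from are obtained by the same growth process
    as in the case [r <= l], with a translation in place of the doubling map
    ([almost_invariant_exists]); therefore the process is studied for a general
    map ([grow], [layer], [card_layer]). *)

(** * Boundaries of finite sets *)

(** Since [A] and its translate have the same size, this one-sided difference
    is half of the symmetric difference; a sequence of finite sets is Folner
    exactly when its boundary in every direction is negligible. *)
Definition bdry (G : zmodType) (g : G) (A : {fset G}) : nat :=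
  #|` (A `\` translate g A)%fset|.

Section Boundary.
Variable G : zmodType.
Implicit Types (g h x : G) (A B : {fset G}).

Lemma in_translate g A x : (x \in translate g A) = (x - g \in A).
Proof.
apply/imfsetP/idP => [[y /= yA ->]|xA]; first by rewrite addrC addKr.
by exists (x - g) => //=; rewrite addrC subrK.
Qed.

Lemma card_translate g A : #|` translate g A| = #|` A|.
Proof. by rewrite card_imfset //; exact: addrI. Qed.

Lemma card_translateD g A : #|` (translate g A `\` A)%fset| = bdry g A.
Proof. by rewrite /bdry !cardfsD card_translate fsetIC. Qed.

Lemma bdryU g A B : (bdry g (A `|` B)%fset <= bdry g A + bdry g B)%N.
Proof.
rewrite /bdry -cardfsUI; apply: leq_trans (leq_addr _ _).
apply/fsubset_leq_card/fsubsetP => x; rewrite !(inE, in_translate).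
by do !case: (_ \in _).
Qed.

Lemma bdryD g A B : (bdry g (A `\` B)%fset <= bdry g A + bdry g B)%N.
Proof.
rewrite -(card_translateD g B) /bdry -cardfsUI; apply: leq_trans (leq_addr _ _).
apply/fsubset_leq_card/fsubsetP => x; rewrite !(inE, in_translate).
by do !case: (_ \in _).
Qed.

Lemma card_translateI g A :
  #|` (A `&` translate g A)%fset| = (#|` A| - bdry g A)%N.
Proof. by rewrite -(cardfsID (translate g A) A) addnK. Qed.

End Boundary.

(** * Sets grown by iterated preimages *)

Lemma card_fibres (T U : choiceType) (f : T -> U)
    (P : {fset T}) (A : {fset U}) :
  (forall x, x \in P -> f x \in A) ->
  #|` P| = (\sum_(y <- A) #|` [fset x in P | f x == y]%fset|)%N.
Proof.
move=> fPA.
rewrite card_fset_sum1.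
rewrite (eq_big_seq (fun x => \sum_(y <- A) (f x == y))%N); last first.
  move=> x /fPA fxA; rewrite (big_fsetD1 (f x)) //= eqxx big1_fset // => y.
  by rewrite !inE eq_sym => /andP[/negPf->].
rewrite exchange_big /=; apply: eq_bigr => y _.
rewrite card_fset_sum1 big_fset /= [RHS]big_mkcond /=.
by apply: eq_bigr => x _; case: eqP.
Qed.

(** [fset_set] sends infinite sets to the empty one, so this is the preimage
    only for maps with finite fibres. *)
Definition preim_fset (T U : choiceType) (f : T -> U) (A : {fset U}) :
    {fset T} :=
  fset_set (f @^-1` [set` A]).

Section Growth.
Variables (T : choiceType) (f : T -> T).
Hypothesis fib_fin : forall y, finite_set (f @^-1` [set y]).
Implicit Types (A B C : {fset T}) (x : T).

Lemma in_preim_fset A x : (x \in preim_fset f A) = (f x \in A).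
Proof.
rewrite in_fset_set; first by apply/idP/idP => [/set_mem|xA] //; exact/mem_set.
apply: (@sub_finite_set _ _ (\bigcup_(y in [set` A]) (f @^-1` [set y]))).
  by move=> z /= zA; exists (f z).
by apply: bigcup_finite => // y _; exact: fib_fin.
Qed.

Lemma card_preim_fset A :
  #|` preim_fset f A| = (\sum_(y <- A) #|` preim_fset f [fset y]%fset|)%N.
Proof.
rewrite (@card_fibres _ _ f _ A) => [|x]; last by rewrite in_preim_fset.
apply: eq_big_seq => y yA; congr (#|` _|); apply/fsetP => x.
by rewrite !inE !in_preim_fset /= inE; case: eqP => [->|]; rewrite ?yA ?andbF.
Qed.

(** The union of the preimages of [C] under the first [k] iterates of [f]. *)
Definition grow C k : {fset T} := iter k (fun U => C `|` preim_fset f U)%fset C.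

Definition layer C k : {fset T} := (grow C k.+1 `\` grow C k)%fset.

Lemma grow_base C k : (C `<=` grow C k)%fset.
Proof. by case: k => [|k] /=; [exact: fsubset_refl | exact: fsubsetUl]. Qed.

(** Unfolding [grow C k.+1], this also says that every point of [grow C k]
    outside [C] is mapped by [f] into [grow C k]. *)
Lemma grow_leS C k : (grow C k `<=` grow C k.+1)%fset.
Proof.
elim: k => [|k IHk]; first exact: grow_base.
apply/fsubsetP => x; rewrite /= !inE !in_preim_fset => /orP[->//|fx].
by move/fsubsetP: IHk => /(_ _ fx) /= ->; rewrite orbT.
Qed.

Lemma preim_growD C k :
  (preim_fset f (grow C k) `\` grow C k `<=` layer C k)%fset.
Proof. by apply/fsetSD/fsubsetUr. Qed.

(** A point that enters at step [k.+2] has an image that entered at step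
    [k.+1]: had the image entered earlier, the point would have done so too. *)
Lemma layer_step C k : (layer C k.+1 `<=` preim_fset f (layer C k))%fset.
Proof.
apply/fsubsetP => x; rewrite /layer !in_preim_fset !inE in_preim_fset.
rewrite -!in_preim_fset.
rewrite -/(grow C k) !in_preim_fset negb_or.
case/andP=> /andP[xC xk] /orP[|xk1]; first by rewrite (negPf xC).
by move: xk1; rewrite /= !inE in_preim_fset=> ->; rewrite andbT.
Qed.

Lemma card_growS C k : #|` grow C k.+1| = (#|` grow C k| + #|` layer C k|)%N.
Proof.
rewrite /layer -(cardfsID (grow C k) (grow C k.+1)); congr (#|` _| + _)%N.
by apply/fsetIidPr/grow_leS.
Qed.

(** If passing to preimages barely enlarges a layer, then by [layer_step] the
    sizes of the layers are almost nonincreasing.  The last layer is then no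
    larger, up to the error, than the average of the layers before it, whose
    disjoint union lies in [grow C k]. *)
Lemma card_layer C k e :
  (forall j, (j < k)%N ->
    #|` preim_fset f (layer C j)| <= #|` layer C j| + e)%N ->
  (k * #|` layer C k| <= #|` grow C k| + k ^ 2 * e)%N.
Proof.
move=> He.
have step j i :
    (i + j <= k -> #|` layer C (i + j)| <= #|` layer C j| + i * e)%N.
  elim: i => [|i IHi] ij; first by rewrite add0n mul0n addn0.
  have := fsubset_leq_card (layer_step C (i + j)).
  have := He (i + j)%N ij; have := IHi (ltnW ij).
  by rewrite addSn mulSn; lia.
suff: forall j, (j <= k -> j * #|` layer C k| <= #|` grow C j| + j * k * e)%N.
  by move/(_ k (leqnn k)); rewrite expnS expn1.
elim=> [|j IHj] jk; first by rewrite mul0n.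
have := step j (k - j)%N; rewrite subnK ?(ltnW jk) // => /(_ (leqnn k)).
have := IHj (ltnW jk); rewrite card_growS; nia.
Qed.

End Growth.

(** The map [f] transforms translations by [g] into translations by [s g].
    This covers translations, with [s] the identity, as well as the doubling
    map, with [s] the doubling map itself. *)
Section EquivariantGrowth.
Variables (G : zmodType) (f s : G -> G) (r : nat).
Hypothesis f_fin : forall y, finite_set (f @^-1` [set y]).
Hypothesis f_le : forall y, (#|` preim_fset f [fset y]%fset| <= r)%N.
Hypothesis f_equiv : forall x g, f (x - g) = f x - s g.
Implicit Types (A C : {fset G}) (g : G).

Lemma card_preim_fset_le A : (#|` preim_fset f A| <= r * #|` A|)%N.
Proof.
rewrite card_preim_fset // card_fset_sum1 big_distrr /=.
by apply: leq_sum => y _; rewrite muln1.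
Qed.

(** The boundary of a preimage is contained in the preimage of a boundary. *)
Lemma bdry_preim_fset g A : (bdry g (preim_fset f A) <= r * bdry (s g) A)%N.
Proof.
rewrite /bdry; apply: leq_trans (card_preim_fset_le _).
apply/fsubset_leq_card/fsubsetP => x.
by rewrite in_preim_fset // !inE !in_translate !in_preim_fset // f_equiv.
Qed.

Lemma bdry_grow g C k :
  (bdry g (grow f C k) <= \sum_(i < k.+1) r ^ i * bdry (iter i s g) C)%N.
Proof.
elim: k g => [|k IHk] g; first by rewrite big_ord1 mul1n.
rewrite big_ord_recl mul1n; apply: leq_trans (bdryU _ _ _) _.
rewrite leq_add2l; apply: leq_trans (bdry_preim_fset _ _) _.
apply: leq_trans (leq_mul (leqnn r) (IHk (s g))) _.
rewrite big_distrr /=; apply: leq_sum => i _.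
by rewrite mulnA -expnS -iterSr.
Qed.

End EquivariantGrowth.

(** * Existence of almost invariant sets *)

Definition almost_invariant (G : zmodType) n (S : seq G) (A : {fset G}) :
    Prop :=
  A != fset0 /\ forall g, g \in S -> (n * bdry g A <= #|` A|)%N.

(** By induction on the list of directions: to add the direction [g], take the
    union of the translates of [A] by [0], [g], ..., [n g].  Its boundary in
    direction [g] lies in the last layer, which is at most a fraction [1 / n]
    of the whole by [card_layer], while the boundaries in the former directions
    grow at most by the factor [n.+1], which the induction hypothesis
    anticipates. *)
Lemma almost_invariant_exists (G : zmodType) n (S : seq G) :
  exists A, almost_invariant n S A.
Proof.
elim: S n => [|g S IHS] n.
  by exists [fset 0]%fset; split => //; rewrite -cardfs_gt0 cardfs1.
have [A [A0 AS]] := IHS (n * n.+1)%N.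
pose f x : G := x - g.
have f1 y : f @^-1` [set y] = [set y + g].
  apply/seteqP; split=> x /=; rewrite /f; [move=> <-|move=> ->].
    by rewrite subrK.
  by rewrite addrK.
have f_fin y : finite_set (f @^-1` [set y]) by rewrite f1.
have preimE B : preim_fset f B = translate g B.
  by apply/fsetP => x; rewrite in_preim_fset // in_translate.
have f_le y : (#|` preim_fset f [fset y]%fset| <= 1)%N.
  by rewrite preimE card_translate cardfs1.
exists (grow f A n); split.
  rewrite -cardfs_gt0 (leq_trans _ (fsubset_leq_card (grow_base _ _ _))) //.
  by rewrite cardfs_gt0.
move=> h; rewrite inE => /predU1P[->|hS].
  rewrite -card_translateD -preimE.
  apply: leq_trans (leq_mul (leqnn n) (fsubset_leq_card (preim_growD _ _ _))) _.
  have := @card_layer _ f f_fin A n 0%N; rewrite muln0 addn0; apply => j _.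
  by rewrite preimE card_translate addn0.
apply: leq_trans (fsubset_leq_card (grow_base f A n)).
apply: leq_trans (AS h hS); rewrite -mulnA leq_mul2l; apply/orP; right.
apply: leq_trans (bdry_grow f_fin f_le (s := id) _ _ _ _) _.
  by move=> x z; rewrite /f addrAC.
rewrite (eq_bigr (fun=> bdry h A)) ?sum_nat_const ?card_ord // => i _.
by rewrite exp1n mul1n iter_fix.
Qed.

(** * Halving a finite set *)

Section Doubling.
Variables (G : zmodType) (l r : nat).
Hypothesis index_2G : (dbl_cosets G #= `I_l)%card.
Hypothesis card_ker : (dbl_ker G #= `I_r)%card.
Implicit Types (A B C T : {fset G}) (g x : G).

Local Notation "'2G'" := (range (@dbl G)).
Local Notation half := (preim_fset (@dbl G)).

Lemma dblB x y : dbl (x - y) = dbl x - dbl y :> G.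
Proof. exact: mulrnBl. Qed.

Lemma dbl_fibre x : @dbl G @^-1` [set dbl x] = [set x + k | k in dbl_ker G].
Proof.
apply/seteqP; split=> y /=.
  move=> yx; exists (y - x); last by rewrite addrC subrK.
  by rewrite /dbl_ker /= dblB yx subrr.
by case=> k kK <-; rewrite /dbl mulrnDl (kK : k *+ 2 = 0) addr0.
Qed.

Lemma dbl_fibre_fin y : finite_set (@dbl G @^-1` [set y]).
Proof.
have [[x _ <-]|ny] := pselect (2G y).
  by rewrite dbl_fibre; apply/finite_image/finite_setP; exists r.
rewrite (_ : _ @^-1` _ = set0) //; apply/seteqP; split => // x /= xy.
by apply: ny; exists x.
Qed.
Local Hint Resolve dbl_fibre_fin : core.

Lemma card_half_fset1 y :
  #|` half [fset y]%fset| = (if y \in 2G then r else 0)%N.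
Proof.
case: ifPn => [/set_mem[x _ <-]|/negP ny].
  apply: card_fset_set; apply: card_eq_trans card_ker.
  rewrite (_ : _ @^-1` _ = (+%R x) @` dbl_ker G); last first.
    rewrite -dbl_fibre; apply/seteqP; split=> z /=; first by rewrite inE => /eqP.
    by move=> ->; rewrite inE.
  by apply: inj_card_eq => a b _ _; exact: addrI.
apply/eqP; rewrite cardfs_eq0; apply/eqP/fsetP => x.
rewrite in_preim_fset // !inE; apply/eqP => xy; apply: ny.
by apply/mem_set; exists x.
Qed.

Definition evens A : {fset G} := [fset x in A | x \in 2G]%fset.

Lemma card_half A : #|` half A| = (r * #|` evens A|)%N.
Proof.
rewrite card_preim_fset // card_fset_sum1 big_fset /= big_mkcond big_distrr /=.
rewrite [RHS]big_mkcond /= -(big_mkcond xpredT) /=.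
apply: eq_bigr => y _; rewrite card_half_fset1.
by case: ifP; rewrite ?muln1 ?muln0.
Qed.

Lemma index_gt0 : (0 < l)%N.
Proof.
rewrite lt0n; apply/eqP => l0; move: index_2G; rewrite l0 II0 card_eq0.
by move=> /eqP/seteqP[/(_ _ (imageP _ (I : [set: G] 0)))].
Qed.

Lemma ker_gt0 : (0 < r)%N.
Proof.
rewrite lt0n; apply/eqP => r0; move: card_ker; rewrite r0 II0 card_eq0.
by move=> /eqP/seteqP[/(_ 0)]; rewrite /dbl_ker /= /dbl mul0rn => /(_ erefl).
Qed.

Lemma mem_2G_opp x : (- x \in 2G) = (x \in 2G).
Proof.
suff H z : z \in 2G -> - z \in 2G by apply/idP/idP => /H; rewrite ?opprK.
by move=> /set_mem[w _ <-]; apply/mem_set; exists (- w); rewrite // /dbl mulNrn.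
Qed.

Lemma mem_2GB x y : x \in 2G -> y \in 2G -> x - y \in 2G.
Proof.
move=> /set_mem[w _ <-] /set_mem[z _ <-]; apply/mem_set.
by exists (w - z); rewrite // dblB.
Qed.

(** The transversal consists of chosen representatives of the cosets.  The
    choice depends only on the coset as a set, so two points have the same
    representative exactly when they are congruent modulo [2G]. *)
Lemma coset_transversal :
  exists (T : {fset G}) (rho : G -> G), #|` T| = l /\
    forall x, rho x \in T /\ forall t, t \in T -> (rho x == t) = (x - t \in 2G).
Proof.
pose coset x : set G := [set (x + h)%R | h in 2G].
pose repr := @xget G 0.
have cosetP x y : coset x y <-> y - x \in 2G.
  split=> [[h hE <-]|/set_mem yx]; first by rewrite addrC addKr; apply/mem_set.
  by exists (y - x) => //; rewrite addrC subrK.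
have coset_eq x y : y - x \in 2G -> coset x = coset y.
  move=> yx; apply/seteqP; split=> z /cosetP zx; apply/cosetP.
    by have := mem_2GB zx yx; rewrite opprB addrA subrK.
  have := mem_2GB zx (etrans (mem_2G_opp _) yx).
  by rewrite opprK addrA subrK.
have reprP x : repr (coset x) - x \in 2G.
  apply/cosetP; apply: xgetPex; exists x; apply/cosetP; rewrite subrr.
  by apply/mem_set; exists 0 => //; rewrite /dbl mul0rn.
have repr_coset x : coset (repr (coset x)) = coset x by apply/esym/coset_eq.
have fin : finite_set (repr @` dbl_cosets G).
  by apply/finite_image/finite_setP; exists l.
exists (fset_set (repr @` dbl_cosets G)), (repr \o coset); split.
  apply: card_fset_set; apply: card_eq_trans index_2G; apply: inj_card_eq.
  move=> _ _ /set_mem[x _ <-] /set_mem[y _ <-]; rewrite -/(coset x) -/(coset y).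
  by move=> e; rewrite -(repr_coset x) e repr_coset.
move=> x; split.
  by rewrite in_fset_set //; apply/mem_set; exists (coset x) => //; exists x.
move=> t; rewrite in_fset_set // => /set_mem[_ [y _ <-]].
rewrite -/(coset y) => <- /=.
apply/eqP/idP => [<-|/coset_eq]; first by rewrite -mem_2G_opp opprB.
by rewrite repr_coset => ->.
Qed.

(** With [T] a transversal of [2G], this bounds the error made when the points
    of [A] are assumed to be equidistributed among the cosets of [2G]. *)
Definition defect T A : nat := (\sum_(t <- T) bdry t A)%N.

(** Translating by [- t] moves the points of [A] in the coset [t + 2G] to points
    of [2G], and all but those in the boundary of [A] stay in [A];
    [card_coset_ge] is the same argument with the opposite translation. *)
Lemma card_coset_le (t : G) A :
  (#|` [fset x in A | (x - t)%R \in 2G]%fset| <= #|` evens A| + bdry t A)%N.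
Proof.
rewrite -(card_translate t (evens A)) /bdry -cardfsUI.
apply: leq_trans (leq_addr _ _).
apply/fsubset_leq_card/fsubsetP => x.
rewrite !(inE, in_translate) /= => /andP[-> ->]; rewrite !andbT orbC.
by case: (_ \in A).
Qed.

Lemma card_coset_ge (t : G) A :
  (#|` evens A| <= #|` [fset x in A | (x - t)%R \in 2G]%fset| + bdry t A)%N.
Proof.
rewrite -(card_translate t (evens A)) -card_translateD -cardfsUI.
apply: leq_trans (leq_addr _ _).
apply/fsubset_leq_card/fsubsetP => x.
rewrite !(inE, in_translate) /= => /andP[-> ->]; rewrite !andbT.
by case: (_ \in A).
Qed.

Lemma card_evens : exists2 T : {fset G}, #|` T| = l & forall A,
  (#|` A| <= l * #|` evens A| + defect T A)%N /\
  (l * #|` evens A| <= #|` A| + defect T A)%N.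
Proof.
have [T [rho [Tl rhoP]]] := coset_transversal.
exists T => // A.
rewrite (@card_fibres _ _ rho A T); last by move=> x _; case: (rhoP x).
rewrite (eq_big_seq (fun t =>
  #|` [fset x in A | x - t \in 2G]%fset|)); last first.
  move=> t tT; congr (#|` _|); apply/fsetP => x; rewrite !inE /=.
  by case: (rhoP x) => _ ->.
rewrite -{1 2}Tl card_fset_sum1 big_distrl /= -!big_split /=.
split; apply: leq_sum => t _; rewrite mul1n; first exact: card_coset_le.
exact: card_coset_ge.
Qed.

(** For an almost invariant [A], halving multiplies the size by about
    [r / l]: about one point in [l] of [A] is divisible by two, and each such
    point has exactly [r] halves. *)
Lemma card_half_bounds : exists2 T : {fset G}, #|` T| = l & forall A,
  (r * #|` A| <= l * #|` half A| + r * defect T A)%N /\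
  (l * #|` half A| <= r * #|` A| + r * defect T A)%N.
Proof.
have [T Tl TP] := card_evens; exists T => // A; have [lo hi] := TP A.
by rewrite card_half; split; nia.
Qed.

End Doubling.

(** * Almost invariant sets that are nearly stable under doubling *)

Section Halvings.
Variables (G : zmodType) (l r : nat).
Hypothesis index_2G : (dbl_cosets G #= `I_l)%card.
Hypothesis card_ker : (dbl_ker G #= `I_r)%card.
Implicit Types (A B C T : {fset G}) (g x : G).

Local Notation half := (preim_fset (@dbl G)).

Local Notation halvings := (grow (@dbl G)).

(** The boundary of the grown set in direction [g] is controlled by the
    boundaries of [C] in the finitely many directions [2 ^ i g], so it suffices
    to take [C] invariant enough in all of these. *)
Lemma halvings_almost_invariant T (S : seq G) k M : #|` T| = l ->
  exists2 C, C != fset0 & forall j, (j <= k)%N ->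
    (forall g, g \in S -> M * bdry g (halvings C j) <= #|` C|)%N /\
    (M * defect T (halvings C j) <= #|` C|)%N.
Proof.
move=> Tl; have l0 := index_gt0 index_2G.
pose R := (\sum_(i < k.+1) r ^ i)%N.
have R0 : (0 < R)%N by rewrite /R big_ord_recl.
(* The powers of [r] account for the multiplicity of the fibres; the factor [l]
   for the number of directions summed up in [defect]. *)
have [C [C0 CS]] := @almost_invariant_exists G (R * (M * l))%N
  [seq iter i (@dbl G) g | i <- iota 0 k.+1, g <- S ++ enum_fset T].
exists C => // j jk.
have bound g : g \in S ++ enum_fset T ->
    (M * l * bdry g (halvings C j) <= #|` C|)%N.
  move=> gS; have fibre_le y : (#|` half [fset y]%fset| <= r)%N.
    by rewrite (card_half_fset1 card_ker); case: ifP.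
  have := bdry_grow (dbl_fibre_fin card_ker) fibre_le (@dblB G) g C j.
  move=> /(leq_mul (leqnn (M * l)))/leq_trans; apply.
  rewrite -(leq_pmul2l R0) mulnA big_distrr /=.
  apply: (@leq_trans (\sum_(i < j.+1) r ^ i * #|` C|)%N).
    apply: leq_sum => i _; rewrite mulnCA leq_mul2l CS ?orbT //.
    apply/allpairsP; exists (nat_of_ord i, g); split=> //.
    by rewrite mem_iota (leq_trans (ltn_ord i)).
  rewrite -big_distrl leq_mul2r; apply/orP; right.
  rewrite (big_ord_widen k.+1 (fun i => r ^ i)%N (jk : (j.+1 <= k.+1)%N)).
  by rewrite /R [leqRHS](bigID (fun i : 'I__ => (i < j.+1)%N)) leq_addr.
split=> [g gS|].
  apply: leq_trans (bound g _); last by rewrite mem_cat gS.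
  by rewrite -mulnA leq_mul2l leq_pmull ?orbT.
rewrite -(leq_pmul2l l0) mulnA (mulnC l) /defect big_distrr /=.
apply: (@leq_trans (\sum_(t <- T) #|` C|)%N).
  rewrite big_seq [leqRHS]big_seq; apply: leq_sum => t tT.
  by apply: bound; rewrite mem_cat tT orbT.
by rewrite big_const_seq count_predT iter_addn_0 mulnC -Tl.
Qed.

(** When [r <= l], halving an almost invariant set does not enlarge it much, and
    neither does halving a layer, which is a difference of two such sets.  So
    [card_layer] applies, and few halves of points of the grown set fall
    outside of it. *)
Lemma card_half_exit_le k C e (T : {fset G}) :
  (forall A, (l * #|` half A| <= r * #|` A| + r * defect T A)%N) ->
  (r <= l)%N -> (forall j, (j <= k)%N -> defect T (halvings C j) <= e)%N ->
  (k * #|` (half (halvings C k) `\` halvings C k)%fset|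
    <= #|` halvings C k| + k ^ 2 * (2 * e))%N.
Proof.
move=> half_le rl def_le; have l0 := index_gt0 index_2G.
have dbl_fin := dbl_fibre_fin card_ker.
apply: leq_trans (leq_mul (leqnn k) (fsubset_leq_card (preim_growD _ _ _))) _.
apply: card_layer => // j jk; rewrite -(leq_pmul2l l0).
apply: leq_trans (half_le _) _.
have defD : (defect T (layer (@dbl G) C j) <= 2 * e)%N.
  apply: (@leq_trans (defect T (halvings C j.+1) + defect T (halvings C j)))%N.
    by rewrite /defect -big_split; apply: leq_sum => t _; exact: bdryD.
  by have := def_le j (ltnW jk); have := def_le j.+1 jk; lia.
by rewrite mulnDr; apply: leq_add; apply: leq_mul.
Qed.

(** When [l < r], the halves of the grown set outnumber it by at least
    [|C| / (2 l)], so each step adds at least that many points and [C] becomes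
    a negligible part of the grown set. *)
Lemma card_halvings_ge k C e (T : {fset G}) :
  (forall A, (r * #|` A| <= l * #|` half A| + r * defect T A)%N) ->
  (l < r)%N -> (forall j, (j <= k)%N -> defect T (halvings C j) <= e)%N ->
  (2 * r * e <= #|` C|)%N ->
  (k * #|` C| <= 2 * l * #|` halvings C k|)%N.
Proof.
move=> half_ge lr def_le eC.
elim: k def_le => [|k IHk] def_le; first by rewrite mul0n.
have {}IHk := IHk (fun j jk => def_le j (leqW jk)).
have kS : (#|` half (halvings C k)| <= #|` halvings C k.+1|)%N.
  exact/fsubset_leq_card/fsubsetUr.
have Ck := fsubset_leq_card (grow_base (@dbl G) C k).
have hk := half_ge (halvings C k); have dk := def_le k (leqnSn k).
move: (#|` half _|) kS hk => h kS hk.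
have lh : (l * h <= l * #|` halvings C k.+1|)%N by rewrite leq_mul2l kS orbT.
have rd : (r * defect T (halvings C k) <= r * e)%N by rewrite leq_mul2l dk orbT.
have lk : ((l + 1) * #|` halvings C k| <= r * #|` halvings C k|)%N.
  by rewrite leq_mul2r addn1 lr orbT.
rewrite mulSn -!mulnA in IHk eC *.
move: lh rd lk hk IHk eC Ck; rewrite mulnDl mul1n.
lia.
Qed.

(** Let [A] be the set obtained from [C] by [k] halvings.  If [r <= l], nearly
    all halves of points of [A] lie in [A], so that the points of [A] whose
    double is in [A] are about [(r / l) |A|] in number.  If [l < r], all points
    of [A] outside of [C] have their double in [A], and [C] is negligible. *)
Lemma doubling_almost_invariant (S : seq G) m : (0 < m)%N ->
  exists A, almost_invariant m S A /\
    (m * (minn l r * #|` A|) <= m * (l * #|` (half A `&` A)%fset|) + #|` A|)%N.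
Proof.
move=> m0; have l0 := index_gt0 index_2G.
have dbl_fin := dbl_fibre_fin card_ker.
have [T Tl TP] := card_half_bounds index_2G card_ker.
(* Both cases need a number of halvings proportional to the precision [m]:
   [4 * m * l] if [r <= l], and [4 * m * l ^ 2] if [l < r].  The three terms of
   [M] absorb the error [k ^ 2 * (2 * e)] of [card_half_exit_le], the error
   [r * e] of [card_half_bounds], and the required invariance. *)
pose k := (4 * (m * (l * l)))%N.
pose M := (4 * k ^ 2 + 2 * m * r + m)%N.
have [C C0 CP] := halvings_almost_invariant S k M Tl.
have C1 : (0 < #|` C|)%N by rewrite cardfs_gt0.
have CA := fsubset_leq_card (grow_base (@dbl G) C k).
set A := halvings C k in CA.
exists A; split.
  split; first by rewrite -cardfs_gt0 (leq_trans C1).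
  move=> g gS; have [/(_ g gS) + _] := CP k (leqnn k).
  by rewrite -/A /M; have : (0 <= 4 * k ^ 2 + 2 * m * r)%N by []; nia.
pose e := (#|` C| %/ M)%N.
have M0 : (0 < M)%N by rewrite /M; lia.
have def_le j : (j <= k -> defect T (halvings C j) <= e)%N.
  by move=> /CP[_]; rewrite /e leq_divRL // mulnC.
have eM : (M * e <= #|` C|)%N by rewrite mulnC leq_trunc_div.
have [rl|lr] := leqP r l.
  have := @card_half_exit_le k C e T (fun B => (TP B).2) rl def_le.
  rewrite -/A => kd; have := (TP A).1; have := def_le k (leqnn k); rewrite -/A.
  rewrite -(cardfsID A (half A)).
  move: #|` (half A `\` A)%fset| kd => d kd; set i := #|` (_ `&` A)%fset|.
  move=> defA lower.
  have rdef : (m * (r * defect T A) <= m * (r * e))%N by rewrite !leq_mul.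
  have mle : (m * (r * #|` A|) <= m * (l * i) + m * (l * d) + m * (r * e))%N.
    by have := leq_mul (leqnn m) lower; rewrite !mulnDr; lia.
  have key : (4 * (m * (l * d)) + 2 * (m * (r * e)) <= 2 * #|` A| + M * e)%N.
    have : (4 * (m * (l * d)) <= k * d)%N.
      by rewrite /k -!mulnA !leq_mul2l leq_pmull ?orbT.
    by rewrite /M; lia.
  lia.
have := @card_halvings_ge k C e T (fun B => (TP B).1) lr def_le.
have -> : (2 * r * e <= #|` C|)%N.
  by apply: leq_trans eM; rewrite leq_mul2r /M; apply/orP; right; nia.
rewrite -/A => /(_ isT); rewrite /k -!mulnA => kC.
have {kC} : (2 * (m * (l * #|` C|)) <= #|` A|)%N.
  have : ((2 * l) * (2 * (m * (l * #|` C|))) <= (2 * l) * #|` A|)%N.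
    by lia.
  by rewrite leq_pmul2l // muln_gt0.
have : (#|` A| <= #|` (half A `&` A)%fset| + #|` C|)%N.
  apply: leq_trans (_ : #|` ((half A `&` A) `|` C)%fset| <= _)%N; last first.
    by rewrite cardfsU leq_subr.
  apply/fsubset_leq_card/fsubsetP => x xA.
  rewrite !inE xA in_preim_fset // andbT.
  have /= := fsubsetP (grow_leS dbl_fin C k) x xA.
  by rewrite inE in_preim_fset // orbC.
move=> cov small.
have : (m * (l * #|` A|)
    <= m * (l * #|` (half A `&` A)%fset|) + m * (l * #|` C|))%N.
  by rewrite -!mulnDr !leq_mul2l cov !orbT.
lia.
Qed.

End Halvings.

(** * Passage to the limit *)

Section Analysis.
Variable R : realType.

Lemma le_limn_einf (u v : (\bar R)^nat) :
  (forall n, (u n <= v n)%E) -> (limn_einf u <= limn_einf v)%E.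
Proof.
move=> uv; rewrite !limn_einf_lim; apply: lee_lim; try exact: is_cvg_einfs.
apply: nearW => n; apply: le_ereal_inf_tmp => _ [k /= nk <-].
by apply: le_trans (uv k); apply: ereal_inf_lbound; exists k.
Qed.

Lemma limn_einf_EFin (u : R^nat) (a : R) :
  u @ \oo --> a -> limn_einf (fun n => (u n)%:E) = a%:E.
Proof.
move=> ua; apply: (cvg_limn_einf_sup _).1.
by apply: cvg_EFin => //; exact: nearW.
Qed.

Variable G : zmodType.
Implicit Types (A : {fset G}) (Phi : nat -> {fset G}).

Lemma natr_neq0_fset A : A != fset0 -> #|` A|%:R != 0 :> R.
Proof. by rewrite pnatr_eq0 -lt0n cardfs_gt0. Qed.

Lemma translate_ratio g A : A != fset0 ->
  #|` (A `&` translate g A)%fset|%:R / #|` A|%:R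
    = 1 - (bdry g A)%:R / #|` A|%:R :> R.
Proof.
move=> A0; rewrite card_translateI natrB; last first.
  by apply: fsubset_leq_card; exact: fsubsetDl.
by rewrite mulrBl divff // natr_neq0_fset.
Qed.

Lemma folner_bdry Phi : (forall N, Phi N != fset0) ->
  folner R Phi <->
  forall g, ((bdry g (Phi N))%:R / #|` Phi N|%:R : R) @[N --> \oo] --> (0 : R).
Proof.
move=> Phi0.
have ratioE g :
    (fun N => #|` (Phi N `&` translate g (Phi N))%fset|%:R / #|` Phi N|%:R : R)
    = (fun N => 1 - (bdry g (Phi N))%:R / #|` Phi N|%:R).
  by apply/funext => N; rewrite translate_ratio.
split=> [[_ H] g|H]; last split=> // g.
  rewrite -(subrr (1 : R)).
  have -> : (fun N => (bdry g (Phi N))%:R / #|` Phi N|%:R) =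
      (fun N => 1 - #|` (Phi N `&` translate g (Phi N))%fset|%:R
        / #|` Phi N|%:R) :> (R^nat).
    by apply/funext => N; rewrite translate_ratio // subKr.
  by apply: cvgB (H g); exact: cvg_cst.
rewrite ratioE -[X in _ --> X](subr0 (1 : R)).
by apply: cvgB (H g); exact: cvg_cst.
Qed.

Section DoublingRatio.
Variables (l r : nat).
Hypothesis index_2G : (dbl_cosets G #= `I_l)%card.
Hypothesis card_ker : (dbl_ker G #= `I_r)%card.

Definition half_ratio A : R :=
  #|` (preim_fset (@dbl G) A `&` A)%fset|%:R / #|` A|%:R.

Lemma doubling_ratioE Phi :
  doubling_ratio R Phi = limn_einf (fun N => (half_ratio (Phi N))%:E).
Proof.
congr limn_einf; apply/funext => N; congr (_%:R / _)%:E.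
congr (#|` _|); apply/fsetP => g.
have dbl_fin := dbl_fibre_fin card_ker.
by rewrite !inE in_preim_fset // andbC.
Qed.

(** The points of [Phi N] whose double is in [Phi N] are among the halves of
    [Phi N], of which there are about [(r / l) |Phi N|] by
    [card_half_bounds]. *)
Lemma doubling_ratio_le Phi : folner R Phi ->
  (doubling_ratio R Phi <= (Num.min 1 (r%:R / l%:R))%:E)%E.
Proof.
move=> FPhi; have Phi0 := FPhi.1; have /(folner_bdry Phi0) bd := FPhi.
have l0 : 0 < l%:R :> R by rewrite ltr0n (index_gt0 index_2G).
have [T _ TP] := card_half_bounds index_2G card_ker.
rewrite doubling_ratioE EFin_min le_min; apply/andP; split.
  rewrite -(limn_einf_EFin (cvg_cst (1 : R))); apply: le_limn_einf => N.
  rewrite lee_fin /half_ratio ler_pdivrMr ?ltr0n ?cardfs_gt0 // mul1r ler_nat.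
  exact/fsubset_leq_card/fsubsetIr.
pose c : R := r%:R / l%:R.
pose u N : R := c + c * \sum_(t <- T) (bdry t (Phi N))%:R / #|` Phi N|%:R.
have uc : u @ \oo --> c.
  have -> : c = c + c * \sum_(t <- T) 0 by rewrite big1_eq mulr0 addr0.
  apply: cvgD; first exact: cvg_cst.
  by apply: cvgMr; apply: cvg_big => [|t _ //]; exact: add_continuous.
rewrite -(limn_einf_EFin uc); apply: le_limn_einf => N.
have A0 : 0 < #|` Phi N|%:R :> R by rewrite ltr0n cardfs_gt0.
rewrite lee_fin /half_ratio /u -mulr_suml ler_pdivrMr // mulrDl.
rewrite -(mulrA c) divfK ?gt_eqF //.
rewrite -mulrDr /c mulrAC ler_pdivlMr // -natr_sum -natrD -!natrM ler_nat.
have := (TP (Phi N)).2; rewrite -mulnDr mulnC => /(leq_trans _); apply.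
by rewrite leq_mul2r fsubset_leq_card ?orbT // fsubsetIl.
Qed.

(** Enumerate [G] and let [Phi N] be the set given by
    [doubling_almost_invariant] for the first [N + 1] elements and the precision
    [N + 1]. *)
Lemma optimal_folner : countable [set: G] ->
  exists2 Phi : nat -> {fset G}, folner R Phi &
    ((Num.min 1 (r%:R / l%:R))%:E <= doubling_ratio R Phi)%E.
Proof.
move=> /countable_injP[code code_inj].
pose e n := xget 0 [set g : G | code g = n].
have codeK g : e (code g) = g.
  apply: xget_unique => //= h hg.
  by apply: code_inj => //; rewrite in_setT.
have l0 : 0 < l%:R :> R by rewrite ltr0n (index_gt0 index_2G).
have [Phi PhiP] := choice (fun N =>
  doubling_almost_invariant index_2G card_ker [seq e i | i <- iota 0 N.+1]
    (ltn0Sn N)).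
have Phi0 N : Phi N != fset0 by case: (PhiP N) => -[].
exists Phi.
  apply/(folner_bdry Phi0) => g.
  apply: (@squeeze_cvgr _ _ _ _ (cst 0) (@harmonic R));
    [|exact: cvg_cst|exact: cvg_harmonic].
  near=> N; rewrite divr_ge0 //= ler_pdivrMr ?ltr0n ?cardfs_gt0 //.
  rewrite mulrC ler_pdivlMr ?ltr0Sn // mulrC -natrM ler_nat.
  have [[_ + ] _] := PhiP N; apply.
  apply/mapP; exists (code g); last by rewrite codeK.
  by rewrite mem_iota /= add0n ltnS; near: N; exact: nbhs_infty_ge.
have minE : Num.min 1 (r%:R / l%:R) = (minn l r)%:R / l%:R :> R.
  have [lr|/ltnW rl] := leqP l r.
    by rewrite divff ?gt_eqF // min_l // ler_pdivlMr // mul1r ler_nat.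
  by rewrite min_r // ler_pdivrMr // mul1r ler_nat.
rewrite minE; set c : R := _ / _.
have lim : (fun N => c - l%:R^-1 * harmonic N) @ \oo --> c.
  rewrite -[X in _ --> X]subr0 -(mulr0 (l%:R^-1 : R)).
  apply: cvgB; first exact: cvg_cst.
  by apply: cvgMr; exact: cvg_harmonic.
rewrite doubling_ratioE -(limn_einf_EFin lim); apply: le_limn_einf => N.
have A0 : 0 < #|` Phi N|%:R :> R by rewrite ltr0n cardfs_gt0.
have [_] := PhiP N; rewrite -(ler_nat R) natrD !natrM.
rewrite lee_fin /half_ratio /harmonic /c ler_pdivlMr //=.
set a := #|` Phi N|%:R; set b := _%:R : R; set n1 : R := N.+1%:R.
have n0 : 0 < n1 by rewrite ltr0Sn.
move=> H; rewrite -invfM -(ler_pM2l (mulr_gt0 n0 l0)).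
rewrite [leLHS](_ : _ = n1 * ((minn l r)%:R * a) - a).
  by rewrite lerBlDr -mulrA.
by field; rewrite !gt_eqF.
Unshelve. all: by end_near. Qed.

End DoublingRatio.
End Analysis.

Theorem theorem6p1 (R : realType) (G : zmodType) (l r : nat)
    (G_countable : countable [set: G])
    (index_2G : (dbl_cosets G #= `I_l)%card)
    (card_ker : (dbl_ker G #= `I_r)%card) :
  [/\ group_doubling_ratio R G = (Num.min 1 (r%:R / l%:R))%:E,
      exists Phi : nat -> {fset G}, folner R Phi /\ quasi_invariant R Phi
    & exists Phi : nat -> {fset G},
        folner R Phi /\ doubling_ratio R Phi = group_doubling_ratio R G].
Proof.
have [Phi FPhi ge] := optimal_folner R index_2G card_ker G_countable.
have le := @doubling_ratio_le R G l r index_2G card_ker.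
have PhiE : doubling_ratio R Phi = (Num.min 1 (r%:R / l%:R))%:E.
  by apply/eqP; rewrite eq_le ge le.
have supE : group_doubling_ratio R G = (Num.min 1 (r%:R / l%:R))%:E.
  apply/eqP; rewrite eq_le -{2}PhiE; apply/andP; split.
    by apply: ge_ereal_sup => _ [Psi FPsi <-]; exact: le.
  by apply: ereal_sup_ubound; exists Phi.
split=> //; exists Phi; split=> //; last by rewrite supE.
rewrite /quasi_invariant PhiE lte_fin lt_min ltr01 divr_gt0 // ltr0n.
  exact: ker_gt0 card_ker.
exact: index_gt0 index_2G.
Qed.
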